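(* Let $\mathcal{F}=(W,\preccurlyeq,V_{\mathcal{F}})$ be a finite poset model. For all $w_1,w_2\in W$: $[w_1]_{\rightleftharpoons}$ and $[w_2]_{\rightleftharpoons}$ are strongly bisimilar in $\mathcal{L}_A(\mathcal{F})$ if and only if $w_1$ and $w_2$ are branching bisimilar in $\mathcal{L}_C(\mathcal{F})$.
   Context: $\mathcal{F}$: finite partial order $(W,\preccurlyeq)$ with valuation $V_{\mathcal{F}}:PL\to2^W$; $V^{-1}(w)=\{p:w\in V_{\mathcal{F}}(p)\}$; $w\leftrightarrow w'$ means $w\preccurlyeq w'$ or $w'\preccurlyeq w$. $w_1\rightleftharpoons w_2$ iff there is a finite sequence $w_1=v_0,\dots,v_\ell=w_2$ with $v_i\leftrightarrow v_{i+1}$ and all $V^{-1}(v_i)$ equal; it is an equivalence with classes $[w]_{\rightleftharpoons}$. $\mathcal{L}_A(\mathcal{F})$: states $W/{\rightleftharpoons}$, labels $2^{PL}\cup\{\mathbf{s},\mathbf{d}\}$, least transition relation with $[w]\xrightarrow{V^{-1}(w)}[w]$ for all $w$, $[w]\xrightarrow{\mathbf{s}}[w']$ if $w\leftrightarrow w'$, $[w]\xrightarrow{\mathbf{d}}[w']$ if $w'\preccurlyeq w$. $\mathcal{L}_C(\mathcal{F})$: states $W$, labels $PL\cup\{\tau,\mathbf{c},\mathbf{d}\}$ (new symbols), least transition relation with $w\xrightarrow{p}w$ if $w\in V_{\mathcal{F}}(p)$; $w\xrightarrow{\tau}w'$ if $w\leftrightarrow w'$ and $V^{-1}(w)=V^{-1}(w')$;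 $w\xrightarrow{\mathbf{c}}w'$ if $w\leftrightarrow w'$ and $V^{-1}(w)\ne V^{-1}(w')$; $w\xrightarrow{\mathbf{d}}w'$ if $w'\preccurlyeq w$. Strong bisimulation: relation $B$ with $B(s_1,s_2)$, $s_1\xrightarrow{\lambda}s_1'$ implying $s_2\xrightarrow{\lambda}s_2'$, $B(s_1',s_2')$, and symmetrically. Write $t\xrightarrow{\tau^*}t'$ if $t=t'$ or there is a finite chain of $\tau$-transitions from $t$ to $t'$. A branching bisimulation is a relation $B$ such that whenever $B(s,t)$ and $s\xrightarrow{\lambda}s'$, either ($\lambda=\tau$ and $B(s',t)$) or there are $\bar t,t'$ with $t\xrightarrow{\tau^*}\bar t\xrightarrow{\lambda}t'$, $B(s,\bar t)$, $B(s',t')$. Two states are (strongly, resp. branching) bisimilar if related by some (strong, resp. branching) bisimulation.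
   Formalization: A branching bisimulation is required to satisfy the transfer condition in both directions (for B and its converse); with the one-directional condition the claim fails, e.g. for two incomparable points with valuations ∅ and {p}. *)

(* Defs.v *)
From HB Require Import structures.
From mathcomp Require Import all_boot all_order.
From mathcomp Require Import boolp classical_sets.
From Stdlib Require Import Relation_Operators.

Set Implicit Arguments.
Unset Strict Implicit.
Unset Printing Implicit Defensive.

Import Order.TTheory.

(** ** Labelled transition systems *)

Definition transfer (S L : Type) (step : S -> L -> S -> Prop)
    (B : S -> S -> Prop) : Prop :=
  forall s1 s2 l s1', B s1 s2 -> step s1 l s1' ->
  exists2 s2', step s2 l s2' & B s1' s2'.

Definition strong_bisimulation (S L : Type) (step : S -> L -> S -> Prop)
    (B : S -> S -> Prop) : Prop :=
  transfer step B /\ transfer step (fun s t => B t s).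

Definition strongly_bisimilar (S L : Type) (step : S -> L -> S -> Prop)
    (s t : S) : Prop :=
  exists2 B : S -> S -> Prop, strong_bisimulation step B & B s t.

Definition tau_star (S L : Type) (tau : L) (step : S -> L -> S -> Prop) :
    S -> S -> Prop :=
  clos_refl_trans S (fun s s' => step s tau s').

Definition branching_transfer (S L : Type) (tau : L)
    (step : S -> L -> S -> Prop) (B : S -> S -> Prop) : Prop :=
  forall s t l s', B s t -> step s l s' ->
  (l = tau /\ B s' t) \/
  exists tbar t', [/\ tau_star tau step t tbar, step tbar l t',
                      B s tbar & B s' t'].

(** A branching bisimulation satisfies the transfer condition in both
    directions; with one direction only, the notion would be a simulation. *)
Definition branching_bisimulation (S L : Type) (tau : L)
    (step : S -> L -> S -> Prop) (B : S -> S -> Prop) : Prop :=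
  branching_transfer tau step B /\
  branching_transfer tau step (fun s t => B t s).

Definition branching_bisimilar (S L : Type) (tau : L)
    (step : S -> L -> S -> Prop) (s t : S) : Prop :=
  exists2 B : S -> S -> Prop, branching_bisimulation tau step B & B s t.

(** ** Finite poset models

    A finite poset model is a [finPOrderType] [W] together with a valuation
    [V : PL -> {set W}]; [PL] is an arbitrary type.  The relation written
    [<->] between points in the literature is [>=<] of [order]. *)

Definition Vinv (d : Order.disp_t) (W : finPOrderType d) (PL : Type)
    (V : PL -> {set W}) (w : W) : set PL :=
  fun p => w \in V p.

(** The sequence [v_0, ..., v_l] is [w1 :: s]. *)
Definition val_connected (d : Order.disp_t) (W : finPOrderType d) (PL : Type)
    (V : PL -> {set W}) (w1 w2 : W) : Prop :=
  exists s : seq W,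
    [/\ path (fun v v' => (v >=< v')%O) w1 s,
        forall v, v \in s -> Vinv V v = Vinv V w1
      & w2 = last w1 s].

Definition val_connectedb (d : Order.disp_t) (W : finPOrderType d) (PL : Type)
    (V : PL -> {set W}) : rel W :=
  fun w1 w2 => `[< val_connected V w1 w2 >].

Lemma val_connectedb_refl (d : Order.disp_t) (W : finPOrderType d)
  (PL : Type) (V : PL -> {set W}) : reflexive (val_connectedb V).
Proof. by move=> w; apply/asboolP; exists [::]. Qed.

Lemma val_connectedb_sym (d : Order.disp_t) (W : finPOrderType d)
  (PL : Type) (V : PL -> {set W}) : symmetric (val_connectedb V).
Proof.
suff sub w1 w2 : val_connected V w1 w2 -> val_connected V w2 w1.
  by move=> w1 w2; apply/asboolP/asboolP; apply: sub.
move=> [s [sP sV ->]]; exists (rev (belast w1 s)).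
have memV v : v \in w1 :: s -> Vinv V v = Vinv V w1.
  by rewrite inE => /predU1P[->|/sV].
split.
- by rewrite rev_path (eq_path (e' := fun v v' => (v >=< v')%O)) // => x y;
    rewrite comparable_sym.
- move=> v; rewrite mem_rev => /mem_belast/memV ->.
  by rewrite [RHS]memV ?mem_last.
- by case: s {sP sV memV} => //= x s; rewrite rev_cons last_rcons.
Qed.

Lemma val_connectedb_trans (d : Order.disp_t) (W : finPOrderType d)
  (PL : Type) (V : PL -> {set W}) : transitive (val_connectedb V).
Proof.
move=> w2 w1 w3 /asboolP[s [sP sV w2E]] /asboolP[t [tP tV w3E]].
apply/asboolP; exists (s ++ t); split.
- by rewrite cat_path sP -w2E.
- have V2 : Vinv V w2 = Vinv V w1.
    by have:= mem_last w1 s; rewrite -w2E inE => /predU1P[->|/sV].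
  by move=> v; rewrite mem_cat => /orP[/sV|/tV ->].
- by rewrite last_cat -w2E.
Qed.

Canonical val_connected_equiv (d : Order.disp_t) (W : finPOrderType d)
    (PL : Type) (V : PL -> {set W}) : equiv_rel W :=
  EquivRel (val_connectedb V) (@val_connectedb_refl d W PL V)
    (@val_connectedb_sym d W PL V) (@val_connectedb_trans d W PL V).

Definition stateA (d : Order.disp_t) (W : finPOrderType d) (PL : Type)
    (V : PL -> {set W}) : Type :=
  {eq_quot (val_connected_equiv V)}%qT.

Definition classA (d : Order.disp_t) (W : finPOrderType d) (PL : Type)
    (V : PL -> {set W}) (w : W) : stateA V :=
  (\pi_({eq_quot (val_connected_equiv V)}) w)%qT.

Lemma classA_eq (d : Order.disp_t) (W : finPOrderType d) (PL : Type)
    (V : PL -> {set W}) (w1 w2 : W) :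
  classA V w1 = classA V w2 <-> val_connected V w1 w2.
Proof.
by split=> [/eqquotP/asboolP|h]; last by apply/eqquotP/asboolP.
Qed.

(** ** The two encodings *)

Inductive labelA (PL : Type) : Type :=
| A_val (a : set PL)
| A_s
| A_d.
Arguments A_s {PL}.
Arguments A_d {PL}.

Inductive stepA (d : Order.disp_t) (W : finPOrderType d) (PL : Type)
    (V : PL -> {set W}) : stateA V -> labelA PL -> stateA V -> Prop :=
| stepA_val (w : W) : stepA (classA V w) (A_val (Vinv V w)) (classA V w)
| stepA_s (w w' : W) : (w >=< w')%O -> stepA (classA V w) A_s (classA V w')
| stepA_d (w w' : W) : (w' <= w)%O -> stepA (classA V w) A_d (classA V w').

Inductive labelC (PL : Type) : Type :=
| C_prop (p : PL)
| C_tau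
| C_c
| C_d.
Arguments C_tau {PL}.
Arguments C_c {PL}.
Arguments C_d {PL}.

Inductive stepC (d : Order.disp_t) (W : finPOrderType d) (PL : Type)
    (V : PL -> {set W}) : W -> labelC PL -> W -> Prop :=
| stepC_prop (w : W) (p : PL) : w \in V p -> stepC V w (C_prop p) w
| stepC_tau (w w' : W) :
    (w >=< w')%O -> Vinv V w = Vinv V w' -> stepC V w C_tau w'
| stepC_c (w w' : W) :
    (w >=< w')%O -> Vinv V w <> Vinv V w' -> stepC V w C_c w'
| stepC_d (w w' : W) : (w' <= w)%O -> stepC V w C_d w'.

(* Main.v *)
Require Import Defs.
From mathcomp Require Import all_boot all_order.
From mathcomp Require Import boolp.
From Stdlib Require Import Relation_Operators.

(** Two points lie in the same class of [L_A] exactly when they are joined by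
    [tau]-steps of [L_C].  Hence a strong bisimulation on classes pulls back to
    points: [tau]-steps stay in a class, and the representative that performs a
    matching [s]- or [d]-step is reached by [tau]-steps.  Conversely, the image
    of a branching bisimulation on classes is a strong bisimulation: a
    [tau]-path from the given representative to the one that moves is matched
    by a [tau]-path on the other side, an [s]-step between equally valued points
    is a [tau]-step (matched by staying), and any other one is a [c]-step. *)

Set Implicit Arguments.
Unset Strict Implicit.
Unset Printing Implicit Defensive.

(** Each [tau]-step is answered by staying put or by [tau]-steps, and these answers concatenate. *)
Lemma branching_transfer_tau_star (S L : Type) (tau : L)
    (step : S -> L -> S -> Prop) (B : S -> S -> Prop) (s s' t : S) :
  branching_transfer tau step B -> tau_star tau step s s' -> B s t ->
  exists2 t', tau_star tau step t t' & B s' t'.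
Proof.
move=> Btr ss'; elim: ss' t => {s s'} [s s' st t Bst|s t Bst|].
- have [[_ Bs't]|[u [t' [tu ut' _ Bs't']]]] := Btr _ _ _ _ Bst st.
    by exists t => //; apply: rt_refl.
  by exists t' => //; apply: rt_trans tu _; apply: rt_step.
- by exists t => //; apply: rt_refl.
- move=> s s' s'' _ IH1 _ IH2 t /IH1[t' tt' /IH2[t'' t't'' Bt'']].
  by exists t'' => //; apply: rt_trans tt' t't''.
Qed.

Lemma branching_bisimulation_sym (S L : Type) (tau : L)
    (step : S -> L -> S -> Prop) (B : S -> S -> Prop) :
  branching_bisimulation tau step B ->
  branching_bisimulation tau step (fun s t => B t s).
Proof. by case. Qed.

Section Encodings.
Context {d : Order.disp_t} {W : finPOrderType d} {PL : Type}.
Variable V : PL -> {set W}.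
Implicit Types w : W.

Lemma Vinv_classA w1 w2 : classA V w1 = classA V w2 -> Vinv V w1 = Vinv V w2.
Proof.
move=> /classA_eq[s [_ sV ->]].
by have := mem_last w1 s; rewrite inE => /predU1P[->|/sV].
Qed.

Lemma classA_tau w1 w2 : stepC V w1 C_tau w2 -> classA V w1 = classA V w2.
Proof.
move=> st; inversion st; subst; apply/classA_eq; exists [:: w2].
by split=> //= [|v]; [rewrite andbT|rewrite inE => /eqP->].
Qed.

Lemma classA_tau_star w1 w2 :
  classA V w1 = classA V w2 <-> tau_star C_tau (stepC V) w1 w2.
Proof.
split=> [/classA_eq[s [sP sV ->]]|].
  elim: s w1 sP sV => [|v s IH] w1 /=; first by move=> *; apply: rt_refl.
  move=> /andP[w1v sP] sV; have vV : Vinv V v = Vinv V w1.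
    by apply: sV; rewrite mem_head.
  apply: (rt_trans _ _ _ v); first by apply: rt_step; apply: stepC_tau.
  by apply: IH => // u us; rewrite vV sV // inE us orbT.
elim=> {w1 w2} [w1 w2|//|w1 w2 w3 _ -> _ -> //].
exact: classA_tau.
Qed.

Lemma stepA_valE (X X' : stateA V) a :
  stepA X (A_val a) X' ->
  exists w, [/\ X = classA V w, X' = classA V w & a = Vinv V w].
Proof. by move=> st; inversion st; exists w. Qed.

Lemma stepA_sE (X X' : stateA V) :
  stepA X A_s X' ->
  exists w w', [/\ X = classA V w, X' = classA V w' & (w >=< w')%O].
Proof. by move=> st; inversion st; exists w, w'. Qed.

Lemma stepA_dE (X X' : stateA V) :
  stepA X A_d X' ->
  exists w w', [/\ X = classA V w, X' = classA V w' & (w' <= w)%O].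
Proof. by move=> st; inversion st; exists w, w'. Qed.

Lemma branching_transfer_classA (B : stateA V -> stateA V -> Prop) :
  transfer (@stepA d W PL V) B ->
  branching_transfer C_tau (stepC V) (fun w w' => B (classA V w) (classA V w')).
Proof.
move=> Btr s t l s' Bst st.
(* The loop at the class of [s] carries the whole valuation in its label, so the matching loop
   forces equality. *)
have VE : Vinv V s = Vinv V t.
  have [Y /stepA_valE[u [tu _ ->]] _] := Btr _ _ _ _ Bst (stepA_val V s).
  by rewrite (Vinv_classA tu).
case: st Bst VE => {s s' l}.
- move=> s p sp Bst VE; right; exists t, t; split=> //; first exact: rt_refl.
  by apply: stepC_prop; have : Vinv V t p by rewrite -VE.
- move=> s s' ss' VE' Bst _; left; split=> //.
  by rewrite -(classA_tau (stepC_tau ss' VE')).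
- move=> s s' ss' VN Bst VE; right.
  have [Y /stepA_sE[u [t' [tu -> ut']]] Bt'] :=
    Btr _ _ _ _ Bst (stepA_s V ss').
  (* The same loop argument gives [t'] the valuation of [s'], so the step from [u] to [t'] changes
     valuation and is a [C_c]-step. *)
  have [Z /stepA_valE[v [t'v _ s'v]] _] := Btr _ _ _ _ Bt' (stepA_val V s').
  exists u, t'; split=> //; [exact/classA_tau_star| |by rewrite -tu].
  apply: stepC_c => //.
  by rewrite -(Vinv_classA tu) -VE (Vinv_classA t'v) -s'v.
- move=> s s' s's Bst VE; right.
  have [Y /stepA_dE[u [t' [tu -> t'u]]] Bt'] :=
    Btr _ _ _ _ Bst (stepA_d V s's).
  exists u, t'; split=> //; [exact/classA_tau_star| |by rewrite -tu].
  exact: stepC_d.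
Qed.

(** The [C_prop p] loop must be matched by such a loop at some [u] reached by [tau]-steps, which
    preserve valuations. *)
Lemma branching_transfer_Vinv (R : W -> W -> Prop) w1 w2 p :
  branching_transfer C_tau (stepC V) R -> R w1 w2 ->
  Vinv V w1 p -> Vinv V w2 p.
Proof.
move=> Rtr R12 w1p; have st : stepC V w1 (C_prop p) w1 by apply: stepC_prop.
have [[]//|[u [v [/classA_tau_star/Vinv_classA-> uv _ _]]]] :=
  Rtr _ _ _ _ R12 st.
by inversion uv.
Qed.

Lemma branching_bisimulation_Vinv (R : W -> W -> Prop) w1 w2 :
  branching_bisimulation C_tau (stepC V) R -> R w1 w2 ->
  Vinv V w1 = Vinv V w2.
Proof.
move=> [Rtr Rtr'] R12; apply/funext => p; apply/propext.
split; first exact: branching_transfer_Vinv Rtr R12.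
exact: (branching_transfer_Vinv Rtr').
Qed.

Definition class_image (R : W -> W -> Prop) (X Y : stateA V) : Prop :=
  exists w1 w2, [/\ X = classA V w1, Y = classA V w2 & R w1 w2].

(** Allows any representative on the left: the [tau]-path to it is matched by one that stays in the
    class [Y]. *)
Lemma class_imageP (R : W -> W -> Prop) w (Y : stateA V) :
  branching_transfer C_tau (stepC V) R -> class_image R (classA V w) Y ->
  exists2 w', Y = classA V w' & R w w'.
Proof.
move=> Rtr [w1 [w2 [/esym/classA_tau_star w1w -> R12]]].
have [w' w2w' Rww'] := branching_transfer_tau_star Rtr w1w R12.
by exists w' => //; apply/classA_tau_star.
Qed.

Lemma transfer_class_image (R : W -> W -> Prop) :
  branching_bisimulation C_tau (stepC V) R ->
  transfer (@stepA d W PL V) (class_image R).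
Proof.
move=> Rbis X Y l X' XY st; have [Rtr _] := Rbis.
case: st XY => {X l X'}.
- move=> s /(class_imageP Rtr)[t -> Rst].
  exists (classA V t); last by exists s, t.
  by rewrite (branching_bisimulation_Vinv Rbis Rst); apply: stepA_val.
- move=> s s' ss' /(class_imageP Rtr)[t -> Rst].
  (* With equal valuations [s] and [s'] share a class, and the reflexive [A_s]-loop at the class of
     [t] answers. *)
  have [VE|VN] := pselect (Vinv V s = Vinv V s').
    exists (classA V t); first exact/stepA_s/Order.POrderTheory.comparablexx.
    by exists s, t; rewrite (classA_tau (stepC_tau ss' VE)).
  have [[]//|[u [t' [/classA_tau_star-> ut' _ Rs't']]]] :=
    Rtr _ _ _ _ Rst (stepC_c ss' VN).
  exists (classA V t'); last by exists s', t'.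
  by inversion ut'; apply: stepA_s.
- move=> s s' s's /(class_imageP Rtr)[t -> Rst].
  have [[]//|[u [t' [/classA_tau_star-> ut' _ Rs't']]]] :=
    Rtr _ _ _ _ Rst (stepC_d V s's).
  exists (classA V t'); last by exists s', t'.
  by inversion ut'; apply: stepA_d.
Qed.

End Encodings.

Theorem theorem5p8 (d : Order.disp_t) (W : finPOrderType d) (PL : Type)
    (V : PL -> {set W}) (w1 w2 : W) :
  strongly_bisimilar (@stepA d W PL V) (classA V w1) (classA V w2) <->
  branching_bisimilar C_tau (stepC V) w1 w2.
Proof.
split=> [[B [Btr Btr'] B12]|[R Rbis R12]].
  exists (fun w w' => B (classA V w) (classA V w')) => //.
  by split; [exact: branching_transfer_classA Btr
            |exact: branching_transfer_classA Btr'].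
exists (class_image R); last by exists w1, w2.
split; first exact: transfer_class_image.
(* The converse of [class_image R] is the class image of the converse of [R], again a branching
   bisimulation. *)
move=> X Y l X' [t [s [-> -> Rts]]] st.
have [] := transfer_class_image (branching_bisimulation_sym Rbis)
  (ex_intro _ s (ex_intro _ t (And3 erefl erefl Rts))) st.
move=> Y' stY' [s' [t' [X'E Y'E Rt's']]].
by exists Y' => //; exists t', s'.
Qed.
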